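(* Let $X$ be an infinite h-homogeneous zero-dimensional compact Hausdorff space and $G=\mathrm{Homeo}(X)$ with the compact-open topology. Then: (1) the $G$-space $X$ is minimal; (2) the $G$-space $X$ is extremely proximal, i.e. for every closed set $\emptyset\ne F\subsetneq X$ there is a net $(g_i)_{i\in I}$ in $G$ and a point $x_0\in X$ with $\lim_i g_iF=\{x_0\}$ in $\mathrm{Exp}(X)$; (3) the minimal $G$-space $X$ is not isomorphic to the universal minimal $G$-space $M(G)$; (4) the $G$-space $\Phi(X)$ is minimal; (5) the $G$-space $\Phi(X)$ is proximal.
   Context: h-homogeneous: every nonempty clopen subset of $X$ is homeomorphic to $X$. $\mathrm{Exp}(X)$ is the space of nonempty closed subsets with the Vietoris topology; $\Phi(X)\subset\mathrm{Exp}(\mathrm{Exp}(X))$ is the compact space of maximal chains (maximal families of nonempty closed sets totally ordered by inclusion), with action $gc=\{gF:F\in c\}$. A $G$-space is minimal if it has no nonempty proper closed invariant subset; it is proximal if for any two points $y_1,y_2$ there is a net $g_i$ in $G$ with $\lim g_iy_1=\lim g_iy_2$. $M(G)$ is the universal minimal $G$-space: the unique (up to isomorphism) minimal $G$-space that maps continuously and equivariantly onto every minimal $G$-space. *)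

(* Defs.v *)
From HB Require Import structures.
From mathcomp Require Import all_boot all_order all_algebra.
From mathcomp Require Import all_classical all_reals all_analysis.

Set Implicit Arguments.
Unset Strict Implicit.
Unset Printing Implicit Defensive.

Local Open Scope classical_set_scope.

Definition homeomorphic (A B : topologicalType) : Prop :=
  exists (f : A -> B) (g : B -> A),
    cancel f g /\ cancel g f /\ continuous f /\ continuous g.

(* h-homogeneity: every nonempty clopen subset (with the subspace topology,
   i.e. the initial topology on the sigma type [set_type U]) is homeomorphic
   to the whole space. *)
Definition h_homogeneous (X : topologicalType) : Prop :=
  forall U : set X, clopen U -> U !=set0 -> homeomorphic (set_type U) X.

Definition is_homeo (X : topologicalType) (f : X -> X) : Prop :=
  exists g : X -> X, cancel f g /\ cancel g f /\ continuous f /\ continuous g.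

Definition Homeo (X : topologicalType) : topologicalType :=
  set_type [set f : {compact-open, X -> X} | @is_homeo X f].

Definition homeo_fun (X : topologicalType) (g : Homeo X) : X -> X := set_val g.

Definition actX (X : topologicalType) (g : Homeo X) (x : X) : X := homeo_fun g x.

Definition vietoris (X : Type) : Type := set X.
HB.instance Definition _ (X : Type) := Choice.on (vietoris X).

Definition vietoris_sub (X : topologicalType) (i : bool * set X) : set (vietoris X) :=
  if i.1 then [set A : set X | A `<=` i.2] else [set A : set X | A `&` i.2 !=set0].

HB.instance Definition _ (X : topologicalType) :=
  isSubBaseTopological.Build (vietoris X)
    [set i : bool * set X | open i.2] (@vietoris_sub X).

Definition Exp (X : topologicalType) : topologicalType :=
  set_type [set A : vietoris X | closed A /\ A !=set0].

Definition exp_set (X : topologicalType) (F : Exp X) : set X := set_val F.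

Definition is_chain (X : topologicalType) (c : set (Exp X)) : Prop :=
  forall F1 F2, c F1 -> c F2 -> exp_set F1 `<=` exp_set F2 \/ exp_set F2 `<=` exp_set F1.

Definition is_maximal_chain (X : topologicalType) (c : set (Exp X)) : Prop :=
  is_chain c /\ forall c', is_chain c' -> c `<=` c' -> c' = c.

Definition Phi (X : topologicalType) : topologicalType :=
  set_type [set C : Exp (Exp X) | is_maximal_chain (exp_set C)].

Definition phi_set (X : topologicalType) (c : Phi X) : set (Exp X) := exp_set (set_val c).

(* Induced actions: gF = g(F) on Exp(X), gc = {gF : F in c} on Phi(X).
   (The image is again an element of the space; it is selected by [xget],
   which returns the unique element with the required underlying set.) *)
Definition actExp (X : topologicalType) (g : Homeo X) (F : Exp X) : Exp X :=
  xget F [set F' : Exp X | exp_set F' = homeo_fun g @` exp_set F].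

Definition actPhi (X : topologicalType) (g : Homeo X) (c : Phi X) : Phi X :=
  xget c [set c' : Phi X | phi_set c' = actExp g @` phi_set c].

Definition is_Gspace (X Y : topologicalType) (act : Homeo X -> Y -> Y) : Prop :=
  [/\ (forall e : Homeo X, homeo_fun e = id -> act e = id),
      (forall g h k : Homeo X, homeo_fun k = homeo_fun g \o homeo_fun h ->
          act k = act g \o act h)
    & continuous (fun p : Homeo X * Y => act p.1 p.2)].

Definition minimal_action (G Y : topologicalType) (act : G -> Y -> Y) : Prop :=
  forall S : set Y, closed S -> S !=set0 ->
    (forall g y, S y -> S (act g y)) -> S = setT.

Definition directed (I : Type) (le : I -> I -> Prop) : Prop :=
  [/\ (forall i, le i i), (forall i j k, le i j -> le j k -> le i k),
      (exists i : I, True) & (forall i j, exists k, le i k /\ le j k)].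

Definition net_converges (I : Type) (le : I -> I -> Prop) (T : topologicalType)
    (u : I -> T) (l : T) : Prop :=
  forall U : set T, nbhs l U -> exists i0, forall i, le i0 i -> U (u i).

Definition proximal_action (G Y : topologicalType) (act : G -> Y -> Y) : Prop :=
  forall y1 y2 : Y, exists (I : Type) (le : I -> I -> Prop) (g : I -> G) (y : Y),
    [/\ directed le, net_converges le (fun i => act (g i) y1) y
      & net_converges le (fun i => act (g i) y2) y].

Definition extremely_proximal_X (X : topologicalType) : Prop :=
  forall F : Exp X, exp_set F <> setT ->
    exists (I : Type) (le : I -> I -> Prop) (g : I -> Homeo X) (x0 : X) (E0 : Exp X),
      [/\ directed le, exp_set E0 = [set x0]
        & net_converges le (fun i => actExp (g i) F) E0].

Definition universal_minimal (X Y : topologicalType) (act : Homeo X -> Y -> Y) : Prop :=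
  [/\ is_Gspace act, compact [set: Y], hausdorff_space Y, (exists y : Y, True) &
      minimal_action act] /\
      forall (Z : topologicalType) (actZ : Homeo X -> Z -> Z),
        is_Gspace actZ -> compact [set: Z] -> hausdorff_space Z ->
        (exists z : Z, True) -> minimal_action actZ ->
        exists f : Y -> Z, [/\ continuous f, (forall z, exists y, f y = z) &
                              forall g y, f (act g y) = actZ g (f y)].

(* Main.v *)
Require Import Defs.
From HB Require Import structures.
From mathcomp Require Import all_boot all_order all_algebra.
From mathcomp Require Import all_classical all_reals all_analysis.

(** A clopen partition of [X], encoded by a locally constant labelling [k], gives each closed set
    [F] its trace [k @` F]; the traces form neighbourhood bases in [Exp X] and in [Phi X]. A maximal
    chain enters any nonempty clopen set through a single point, so after refinement the blocks of a
    partition are entered one at a time, in a linear order, and this order determines the traces of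
    the chain. By h-homogeneity every bijection between two clopen partitions is induced by a
    homeomorphism. Since one partition with any prescribed number of blocks can be chosen to be
    entered in the same order by two given chains, a single homeomorphism moves both chains into a
    given neighbourhood of a third: this gives minimality and proximality of [Phi X].

    For non-universality, consider the compact space of all choices, for each pair of distinct clopen
    sets, of one of its two orderings. A homeomorphism fixing [x] and swapping two clopen sets fixes
    no such choice, so no minimal subset of this space is an equivariant image of [X]. *)

Local Open Scope classical_set_scope.
Set Implicit Arguments.
Unset Strict Implicit.
Unset Printing Implicit Defensive.

(** * The Vietoris topology *)

(** A chain of nonempty closed sets is a base of a proper filter, and a cluster point of that filter
    lies in every member. *)
Lemma chain_closed_bigcap (T : topologicalType) (C : set (set T)) :
  compact [set: T] -> C !=set0 -> total_on C subset ->
  (forall A, C A -> closed A /\ A !=set0) -> exists x, forall A, C A -> A x.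
Proof.
move=> cT [A0 CA0] totC clC.
have FF : ProperFilter (filter_from C id).
  apply: filter_from_proper; last by move=> A /clC[].
  apply: filter_from_filter; first by exists A0.
  move=> A B CA CB; case: (totC _ _ CA CB) => h.
    by exists A => //= x Ax; split => //; exact: h.
  by exists B => //= x Bx; split => //; exact: h.
have [x [_ clx]] := cT _ FF filterT.
exists x => A CA; case: (clC _ CA) => clA _; apply: clA => B nB.
by apply: clx nB; exists A.
Qed.

Lemma exp_set_inj (X : topologicalType) : injective (@exp_set X).
Proof. exact: val_inj. Qed.

Lemma exp_closed (X : topologicalType) (F : Exp X) : closed (exp_set F).
Proof. by case: F => A /= /[dup] /set_mem[]. Qed.

Lemma exp_neq0 (X : topologicalType) (F : Exp X) : exp_set F !=set0.
Proof. by case: F => A /= /[dup] /set_mem[]. Qed.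

Lemma exp_mk (X : topologicalType) (A : set X) :
  closed A -> A !=set0 -> exists F : Exp X, exp_set F = A.
Proof.
move=> cA A0.
by exists (SigSub (mem_set (conj cA A0 : [set A : vietoris X | closed A /\ A !=set0] A))).
Qed.

Lemma open_set_val (T : topologicalType) (A : set T) (U : set T) :
  open U -> open [set x : set_type A | U (set_val x)].
Proof. by move=> oU; exists U. Qed.

Lemma cvg_set_type (T : topologicalType) (A : set T)
    (G : set_system (set_type A)) (x : set_type A) :
  Filter G -> set_val @ G --> set_val x -> G --> x.
Proof.
move=> FG cvG N [_ [[W oW <-] Wx WN]]; apply: filterS WN _.
by apply: cvG; exact: open_nbhs_nbhs.
Qed.

Lemma open_vietoris_sub (X : topologicalType) (i : bool * set X) :
  open i.2 -> open (@vietoris_sub X i : set (vietoris X)).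
Proof.
move=> oi; exists [set vietoris_sub i]; last by rewrite bigcup_set1.
by move=> _ ->; apply: finI_from1.
Qed.

(** A basic neighbourhood is a finite intersection of subbasic sets, so convergence can be tested on
    the two subbasic kinds. *)
Lemma cvg_vietoris (X : topologicalType) (G : set_system (vietoris X)) (A : vietoris X) :
  Filter G ->
  (forall U, open U -> A `<=` U -> G [set B : set X | B `<=` U]) ->
  (forall U, open U -> A `&` U !=set0 -> G [set B : set X | B `&` U !=set0]) ->
  G --> A.
Proof.
move=> FG Gsub Ghit N; rewrite nbhsE => -[W [[D fD <-] [B DB BA] WN]].
apply: filterS WN _; have [D' D'o D'B] := fD _ DB.
suff : G B by apply: filterS => x Bx; exists B.
rewrite -D'B; apply: filter_bigI => -[b U] /[dup] iD' /D'o /set_mem /= oU.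
move: BA; rewrite -D'B => /(_ _ iD').
by rewrite /vietoris_sub /=; case: b {iD'} => /= h; [exact: Gsub|exact: Ghit].
Qed.

Lemma open_exp_sub (X : topologicalType) (U : set X) :
  open U -> open [set F : Exp X | exp_set F `<=` U].
Proof.
by move=> oU; exists (vietoris_sub (true, U)) => //; exact: open_vietoris_sub.
Qed.

Lemma open_exp_hit (X : topologicalType) (U : set X) :
  open U -> open [set F : Exp X | exp_set F `&` U !=set0].
Proof.
by move=> oU; exists (vietoris_sub (false, U)) => //; exact: open_vietoris_sub.
Qed.

Lemma cvg_exp (X : topologicalType) (G : set_system (Exp X)) (F : Exp X) :
  Filter G ->
  (forall U, open U -> exp_set F `<=` U -> G [set E | exp_set E `<=` U]) ->
  (forall U, open U -> exp_set F `&` U !=set0 -> G [set E | exp_set E `&` U !=set0]) ->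
  G --> F.
Proof. by move=> FG h1 h2; apply: cvg_set_type; apply: cvg_vietoris. Qed.

(** Comparability with a fixed [F] in [c] is a closed condition: if [x] in [A] lies outside [F] and
    [y] in [F] lies outside [A], then all sets near [A] also leave [F] and miss [y]. So a limit [A]
    of [c] can be added to [c], and maximality puts it there. *)
Lemma closed_maximal_chain (X : topologicalType) (c : set (Exp X)) :
  hausdorff_space X -> is_maximal_chain c -> closed c.
Proof.
move=> hX [chc maxc] A clA.
have cmp F : c F -> exp_set A `<=` exp_set F \/ exp_set F `<=` exp_set A.
  move=> cF; apply: contrapT => /not_orP[/existsNP[x /not_implyP[Ax nFx]] /existsNP[y /not_implyP[Fy nAy]]].
  have oF : open (~` exp_set F) by apply: closed_openC; exact: exp_closed.
  have oy : open (~` [set y]).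
    by apply: closed_openC; apply: accessible_closed_set1; exact: hausdorff_accessible.
  have [|E [cE [/= Ey [z [Ez nFz]]]]] := clA (
      [set E : Exp X | exp_set E `<=` ~` [set y]] `&`
      [set E : Exp X | exp_set E `&` ~` exp_set F !=set0]).
    apply: open_nbhs_nbhs; split; first by apply: openI; [exact: open_exp_sub|exact: open_exp_hit].
    by split => /=; [move=> z Az zy; apply: nAy; rewrite -zy|exists x].
  case: (chc _ _ cE cF) => h; first by apply: nFz; exact: h.
  by apply: (Ey y) => //; exact: h.
have <- : c `|` [set A] = c.
  apply: maxc; last by move=> F; left.
  move=> F1 F2 [c1|->] [c2|->]; [exact: chc| |exact: cmp|by left].
  by case: (cmp _ c1) => h; [right|left].
by right.
Qed.

Lemma compact_exp (X : topologicalType) :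
  compact [set: X] -> compact [set: Exp X].
Proof.
move=> cX; rewrite compact_ultra => G UG _.
(* [L] will be the limit of [G] *)
pose L := [set x : X | forall U, open U -> U x -> G [set F : Exp X | exp_set F `&` U !=set0]].
(* A point outside [L] has a neighbourhood missed by [G]-almost every set, because [G] is an
   ultrafilter; compactness of [K] makes this uniform over [K]. *)
have miss K : closed K -> K `&` L = set0 -> G [set F : Exp X | exp_set F `&` K = set0].
  move=> clK KL.
  have /compact_near_coveringP ncK := subclosed_compact clK cX (@subsetT _ K).
  have : \forall F \near G, K `<=` (fun x => ~ exp_set F x).
    apply: ncK => x Kx.
    have /existsNP[U /not_implyP[oU /not_implyP[Ux nG]]] : ~ L x.
      by move=> Lx; have : (K `&` L) x by []; rewrite KL.
    exists (U, ~` [set F : Exp X | exp_set F `&` U !=set0]).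
      split => /=; first exact: open_nbhs_nbhs.
      by case: (in_ultra_setVsetC [set F : Exp X | exp_set F `&` U !=set0] UG).
    by move=> [y F] [/= Uy nF] Fy; apply: nF; exists y.
  apply: filterS => F /= KF; rewrite -subset0 => x [Fx Kx].
  exact: (KF x).
have clL : closed L.
  move=> x clx U oU Ux; have [//|y [Ly Uy]] := clx U; first exact: open_nbhs_nbhs.
  exact: Ly.
have L0 : L !=set0.
  apply/set0P/eqP => L0; have := miss setT closedT; rewrite L0 setI0 => /(_ erefl).
  move=> /filter_ex[F]; rewrite /= setIT; apply/eqP/set0P; exact: exp_neq0.
have [E EL] := exp_mk clL L0; exists E; split => //=.
apply: cvg_exp; rewrite EL => U oU.
  move=> LU; have /miss : closed (~` U) by exact: open_closedC.
  rewrite (_ : ~` U `&` L = set0); last by rewrite -subset0 => x [nU /LU].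
  move=> /(_ erefl); apply: filterS => F; rewrite /= -subset0 => FU x Fx.
  by apply: contrapT => nUx; apply: (FU x).
by move=> [x [Lx Ux]]; exact: Lx.
Qed.

(** * Traces on clopen partitions *)

Definition locally_constant (X : topologicalType) (I : Type) (k : X -> I) :=
  forall x, \forall y \near x, k y = k x.

Definition clopens (X : topologicalType) (s : seq (set X)) :=
  forall A, A \in s -> clopen A.

(** The fibres are the atoms of the Boolean algebra generated by [s], so a finite list of clopen
    sets encodes a clopen partition, and a longer list a finer one. *)
Definition label (X : topologicalType) (s : seq (set X)) (x : X) : seq bool :=
  [seq `[< A x >] | A <- s].

(** Two labellings are allowed because a homeomorphism will carry one partition to another. *)
Definition same_traces (X : topologicalType) (I : Type) (k l : X -> I)
    (c d : set (Exp X)) :=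
  (forall F, c F -> exists2 E, d E & k @` exp_set F = l @` exp_set E) /\
  (forall E, d E -> exists2 F, c F & k @` exp_set F = l @` exp_set E).

Lemma clopen_locally_constant (X : topologicalType) (I : Type) (k : X -> I) (P : set I) :
  locally_constant k -> clopen (k @^-1` P).
Proof.
move=> kl.
have op Q : open (k @^-1` Q).
  by rewrite openE => x Qx; near=> y; rewrite /preimage /= (near (kl x) y).
split; first exact: op.
by rewrite -[_ @^-1` _]setCK preimage_setC; apply: open_closedC; exact: op.
Unshelve. all: by end_near. Qed.

Lemma clopen_near (X : topologicalType) (A : set X) (x : X) :
  clopen A -> \forall y \near x, A y = A x.
Proof.
move=> [oA cA]; have [Ax|nAx] := pselect (A x).
  have : nbhs x A by exact: open_nbhs_nbhs.
  by apply: filterS => y Ay; apply/propext; split.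
have : nbhs x (~` A) by apply: open_nbhs_nbhs; split => //; exact: closed_openC.
by apply: filterS => y Ay; apply/propext; split.
Qed.

Lemma label_locally_constant (X : topologicalType) (s : seq (set X)) :
  clopens s -> locally_constant (label s).
Proof.
elim: s => [|A s IH] cs x; first exact: nearW.
have {}IH := IH (fun B Bs => cs B (mem_behead (s := A :: s) Bs)) x.
have cA := clopen_near x (cs A (mem_head _ _)).
by near=> y; rewrite /label /= (near cA y)// -/(label s y) (near IH y).
Unshelve. all: by end_near. Qed.

Lemma label_eqP (X : topologicalType) (s : seq (set X)) x y :
  label s x = label s y <-> (forall A, A \in s -> A x = A y).
Proof.
split=> [/eq_in_map h A As|h].
  have /= E := h _ As; apply/propext.
  by split=> /asboolP Az; apply/asboolP; rewrite ?E// -E.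
by apply/eq_in_map => A As; rewrite (h _ As).
Qed.

Lemma image_factor (X I J : Type) (k : X -> I) (l : X -> J) (E F : set X) :
  (forall x y, k x = k y -> l x = l y) -> k @` E = k @` F -> l @` E = l @` F.
Proof.
move=> kl.
have h A B : k @` A = k @` B -> l @` A `<=` l @` B.
  move=> AB _ [x Ax <-]; have : (k @` A) (k x) by exists x.
  by rewrite AB => -[y By /kl <-]; exists y.
by move=> EF; apply/seteqP; split; exact: h.
Qed.

Lemma label_image_sub (X : topologicalType) (s t : seq (set X)) (E F : set X) :
  {subset s <= t} -> label t @` E = label t @` F -> label s @` E = label s @` F.
Proof.
move=> st; apply: image_factor => x y /label_eqP h.
by apply/label_eqP => A /st; exact: h.
Qed.

Lemma label_range (X : topologicalType) (s : seq (set X)) :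
  exists D : seq (seq bool), forall x, label s x \in D.
Proof.
elim: s => [|A s [D DP]]; first by exists [:: [::]] => x; rewrite inE.
exists (map (cons true) D ++ map (cons false) D) => x.
rewrite /label /= mem_cat; apply/orP.
by case: asboolP => _; [left|right]; apply: map_f; exact: DP.
Qed.

Lemma filter_all (T : eqType) (Y : Type) (G : set_system Y) (D : seq T)
    (Q : T -> set Y) :
  Filter G -> (forall b, b \in D -> G (Q b)) ->
  G [set y | forall b, b \in D -> Q b y].
Proof.
move=> FG; elim: D => [|b D IH] h; first by apply: filterE.
have /filterI : G (Q b) by apply: h; exact: mem_head.
have /[swap] /[apply] : G [set y | forall b, b \in D -> Q b y].
  by apply: IH => b' Db'; apply: h; rewrite inE Db' orbT.
apply: filterS => y [Qb QD] b'; rewrite inE => /predU1P[->//|]; exact: QD.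
Qed.

(** Concatenation refines two lists at once, so one can pass to the limit along ever finer clopen
    partitions. *)
Lemma clopens_filter (X : topologicalType) (Y : Type) (P : seq (set X) -> set Y) :
  (forall s t, {subset s <= t} -> P t `<=` P s) ->
  Filter (filter_from [set s | clopens s] P).
Proof.
move=> Psub; apply: filter_from_filter; first by exists [::].
move=> s t cs ct; exists (s ++ t).
  by move=> A; rewrite mem_cat => /orP[/cs|/ct].
by move=> y Py; split; apply: Psub Py => A; rewrite mem_cat => ->; rewrite ?orbT.
Qed.

Section ZeroDim.
Variable X : topologicalType.
Hypotheses (cX : compact [set: X]) (hX : hausdorff_space X) (zX : zero_dimensional X).

Lemma clopen_nbhs (x : X) (U : set X) : nbhs x U -> exists A, [/\ clopen A, A x & A `<=` U].
Proof.
move=> Ux.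
have [A [Ax cA] AU] : filter_from [set D : set X | D x /\ clopen D] id U.
  exact: (zero_dimensional_cvg hX zX cX).
by exists A.
Qed.

Lemma clopen_between (K U : set X) : closed K -> open U -> K `<=` U ->
  exists A, [/\ clopen A, K `<=` A & A `<=` U].
Proof.
move=> cK oU KU.
pose D := [set A | clopen A /\ A `<=` U].
(* Clopen subsets of [U] are directed by union; along this filter, near-covering compactness of [K]
   replaces a finite subcover. *)
have FF : Filter (filter_from D (fun A => [set B | D B /\ A `<=` B])).
  apply: filter_from_filter; first by exists set0; split => //; exact: clopen0.
  move=> A B [cA AU] [cB BU]; exists (A `|` B).
    by split; [exact: clopenU|move=> x [/AU|/BU]].
  by move=> E [DE ABE]; split; split => // x h; apply: ABE; [left|right].
have /compact_near_coveringP ncK := subclosed_compact cK cX (@subsetT _ K).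
have : filter_from D (fun A => [set B | D B /\ A `<=` B]) [set B | K `<=` B].
  apply: (ncK _ _ (fun B x => B x) FF).
  move=> x Kx; have [|A [cA Ax AU]] := @clopen_nbhs x U.
    by apply: open_nbhs_nbhs; split => //; exact: KU.
  exists (A, [set B | D B /\ A `<=` B]); last by move=> [y B] [/= Ay [_ AB]]; exact: AB.
  split => /=; first by apply: open_nbhs_nbhs; split => //; case: cA.
  by exists A.
by move=> [A DA /(_ A)/= KA]; exists A; case: (DA) => ? ?; split => //; apply: KA; split.
Qed.

(** A single clopen set handles each subbasic condition: one between [F] and [U] if [F] lies in [U],
    one inside [U] around a common point if [F] meets [U]. *)
Lemma exp_trace_nbhs (F : Exp X) (N : set (Exp X)) : nbhs F N ->
  exists2 s, clopens s &
    forall E, label s @` exp_set E = label s @` exp_set F -> N E.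
Proof.
pose P s := [set E : Exp X | label s @` exp_set E = label s @` exp_set F].
have FG : Filter (filter_from [set s | clopens s] P).
  by apply: clopens_filter => s t st E; exact: label_image_sub.
suff : filter_from [set s | clopens s] P --> F by move=> /[apply] -[s cs Ps]; exists s.
have sing A : clopen A -> clopens [:: A] by move=> cA B; rewrite inE => /eqP ->.
have in1 A x y : label [:: A] x = label [:: A] y -> A y -> A x.
  by move/label_eqP => /(_ A (mem_head _ _)) ->.
apply: cvg_exp => U oU.
  move=> /(clopen_between (@exp_closed _ F) oU)[A [cA FA AU]].
  exists [:: A]; first exact: sing.
  move=> E /= EF x Ex; apply: AU.
  have : (label [:: A] @` exp_set E) (label [:: A] x) by exists x.
  by rewrite EF => -[y /FA Ay /esym /in1]; exact.
move=> [x [Fx Ux]].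
have [|A [cA Ax AU]] := @clopen_nbhs x U; first exact: open_nbhs_nbhs.
exists [:: A]; first exact: sing.
move=> E /= EF.
have : (label [:: A] @` exp_set F) (label [:: A] x) by exists x.
by rewrite -EF => -[y Ey /in1/(_ Ax)/AU Uy]; exists y.
Qed.

(** A hit condition concerns one member of [c] and follows from [exp_trace_nbhs]. A containment
    condition concerns all members; as [phi_set c] is compact in [Exp X], one list serves them
    all. *)
Lemma phi_trace_nbhs (c : Phi X) (N : set (Phi X)) : nbhs c N ->
  exists2 s, clopens s &
    forall d, same_traces (label s) (label s) (phi_set d) (phi_set c) -> N d.
Proof.
pose P s := [set d : Phi X | same_traces (label s) (label s) (phi_set d) (phi_set c)].
have FG : Filter (filter_from [set s | clopens s] P).
  apply: clopens_filter => s t st d [h1 h2]; split.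
    by move=> F /h1[E cE EF]; exists E => //; exact: label_image_sub EF.
  by move=> F /h2[E cE EF]; exists E => //; exact: label_image_sub EF.
suff : filter_from [set s | clopens s] P --> c by move=> /[apply] -[s cs Ps]; exists s.
apply: cvg_set_type; apply: cvg_exp => U oU; last first.
  move=> [F [cF UF]]; have [|s cs sU] := @exp_trace_nbhs F U; first exact: open_nbhs_nbhs.
  exists s => // d [_ /(_ _ cF)[E dE EF]]; exists E; split => //.
  exact: sU.
move=> cU.
have /compact_near_coveringP nc : compact (phi_set c).
  by apply: (subclosed_compact _ (compact_exp cX)) => //; exact: exp_closed.
pose Q (s : seq (set X)) := [set t : seq (set X) | clopens t /\ {subset s <= t}].
have FQ : Filter (filter_from [set s | clopens s] Q).
  by apply: clopens_filter => s t st u [cu tu]; split => // A /st /tu.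
have : filter_from [set s | clopens s] Q [set s | phi_set c `<=` (fun F => forall E,
   label s @` exp_set E = label s @` exp_set F -> U E)].
  apply: (nc _ _ (fun s F => forall E,
    label s @` exp_set E = label s @` exp_set F -> U E) FQ).
  move=> F cF; have [|s cs sU] := @exp_trace_nbhs F U.
    by apply: open_nbhs_nbhs; split => //; exact: cU.
  exists ([set E | label s @` exp_set E = label s @` exp_set F], Q s).
    split => /=; last by exists s.
    have lc := label_locally_constant cs.
    (* The trace under [label s] is locally constant at [F]: nearby sets stay in the blocks met by
       [F] and, these being finitely many, still meet each of them. *)
    pose V := label s @^-1` (label s @` exp_set F).
    have : nbhs F [set E : Exp X | exp_set E `<=` V /\
        forall x, exp_set F x -> exp_set E `&` label s @^-1` [set label s x] !=set0].
      have cV R : clopen (label s @^-1` R) by exact: clopen_locally_constant.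
      have [D DP] := label_range s.
      have : \forall E \near F, forall b, b \in D -> (label s @` exp_set F) b ->
          exp_set E `&` label s @^-1` [set b] !=set0.
        apply: filter_all => b _; have [Fb|nFb] := pselect ((label s @` exp_set F) b).
          apply: (@filterS _ _ _ [set E | exp_set E `&` label s @^-1` [set b] !=set0]) => //.
          apply: open_nbhs_nbhs; split; first by apply: open_exp_hit; case: (cV [set b]).
          by case: Fb => x Fx xb; exists x.
        by apply: filterE => E /nFb.
      have : nbhs F [set E : Exp X | exp_set E `<=` V].
        apply: open_nbhs_nbhs; split; first by apply: open_exp_sub; case: (cV (label s @` exp_set F)).
        by move=> x Fx; exists x.
      apply: filterS2 => E EV Eh; split => // x Fx.
      by apply: Eh => //; exists x.
    apply: filterS => E [EV Ehit]; apply/seteqP; split.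
      by move=> _ [x /EV ? <-].
    by move=> _ [x /Ehit[y [Ey /= yx]] <-]; exists y.
  move=> [E t] [/= EF [ct st]] E' E'E; apply: sU.
  by rewrite -EF; exact: label_image_sub E'E.
move=> [s cs sP]; exists s => // d [h _] E dE.
have [F cF EF] := h _ dE.
by apply: (sP s _ F cF) => //; split.
Qed.

End ZeroDim.

(** * Constructing homeomorphisms *)

Lemma homeo_funP (X : topologicalType) (g : Homeo X) : is_homeo (homeo_fun g).
Proof. by case: g => f /= /[dup] /set_mem. Qed.

Lemma homeo_mk (X : topologicalType) (f : X -> X) :
  is_homeo f -> exists g : Homeo X, homeo_fun g = f.
Proof.
move=> hf.
by exists (SigSub (mem_set (hf : [set f : {compact-open, X -> X} | @is_homeo X f] f))).
Qed.

Lemma homeo_inv (X : topologicalType) (g : Homeo X) : exists h : Homeo X,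
  cancel (homeo_fun g) (homeo_fun h) /\ cancel (homeo_fun h) (homeo_fun g).
Proof.
have [h [gK [hK [cg ch]]]] := homeo_funP g.
have [h' h'E] : exists h' : Homeo X, homeo_fun h' = h.
  by apply: homeo_mk; exists (homeo_fun g).
by exists h'; rewrite h'E.
Qed.

Lemma homeo_continuous (X : topologicalType) (g : Homeo X) : continuous (homeo_fun g).
Proof. by have [h [_ [_ []]]] := homeo_funP g. Qed.

Lemma actExpE (X : topologicalType) (g : Homeo X) (F : Exp X) :
  exp_set (actExp g F) = homeo_fun g @` exp_set F.
Proof.
apply: (@xgetPex _ F [set F' | exp_set F' = homeo_fun g @` exp_set F]).
have [h [gh hg]] := homeo_inv g.
apply: exp_mk; last by have [x Fx] := exp_neq0 F; exists (homeo_fun g x); exists x.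
rewrite (_ : _ @` _ = homeo_fun h @^-1` exp_set F).
  by have /continuous_closedP := @homeo_continuous _ h; apply; exact: exp_closed.
apply/seteqP; split=> [_ [x Fx <-]|x Fx]; first by rewrite /preimage /= gh.
by exists (homeo_fun h x).
Qed.

Lemma actExp_cancel (X : topologicalType) (g h : Homeo X) :
  cancel (homeo_fun g) (homeo_fun h) -> cancel (actExp g) (actExp h).
Proof.
move=> gh F; apply: exp_set_inj; rewrite !actExpE image_comp.
by rewrite -[RHS]image_id; apply: eq_imagel => x _; rewrite /= gh.
Qed.

Lemma actExp_sub (X : topologicalType) (g : Homeo X) (E F : Exp X) :
  exp_set E `<=` exp_set F -> exp_set (actExp g E) `<=` exp_set (actExp g F).
Proof. by rewrite !actExpE; exact: image_subset. Qed.

Lemma actExp_chain (X : topologicalType) (g : Homeo X) (c : set (Exp X)) :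
  is_chain c -> is_chain (actExp g @` c).
Proof.
by move=> chc _ _ [E cE <-] [F cF <-]; case: (chc _ _ cE cF) => h; [left|right]; exact: actExp_sub.
Qed.

Lemma actExp_maximal_chain (X : topologicalType) (g : Homeo X) (c : set (Exp X)) :
  is_maximal_chain c -> is_maximal_chain (actExp g @` c).
Proof.
move=> [chc maxc]; split; first exact: actExp_chain.
have [h [/actExp_cancel gh /actExp_cancel hg]] := homeo_inv g.
move=> d chd cd; rewrite -(maxc (actExp h @` d)) ?image_comp.
- by rewrite -[LHS]image_id; apply: eq_imagel => F _; rewrite /= hg.
- exact: actExp_chain.
- by move=> F cF; exists (actExp g F); rewrite ?gh//; apply: cd; exists F.
Qed.

Lemma phi_maximal_chain (X : topologicalType) (c : Phi X) : is_maximal_chain (phi_set c).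
Proof. by case: c => c /= /[dup] /set_mem. Qed.

Lemma maximal_chain_comparable (X : topologicalType) (c : set (Exp X)) (E : Exp X) :
  is_maximal_chain c -> (forall F, c F -> exp_set F `<=` exp_set E \/ exp_set E `<=` exp_set F) ->
  c E.
Proof.
move=> [chc maxc] cmp; rewrite -(maxc (c `|` [set E])); [by right| |by move=> F; left].
move=> F1 F2 [c1|->] [c2|->]; [exact: chc|exact: cmp| |by left].
by case: (cmp _ c2); [right|left].
Qed.

(** The image of [c] is a maximal chain, hence closed in [Exp X], so the [xget] in [actPhi] has a
    genuine witness. *)
Lemma actPhiE (X : topologicalType) (g : Homeo X) (c : Phi X) : hausdorff_space X ->
  phi_set (actPhi g c) = actExp g @` phi_set c.
Proof.
move=> hX.
apply: (@xgetPex _ c [set c' | phi_set c' = actExp g @` phi_set c]).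
have mc := actExp_maximal_chain g (phi_maximal_chain c).
have [C CE] : exists C : Exp (Exp X), exp_set C = actExp g @` phi_set c.
  apply: exp_mk; first exact: closed_maximal_chain mc.
  by have [F cF] := exp_neq0 (set_val c); exists (actExp g F); exists F.
have mC : [set C : Exp (Exp X) | is_maximal_chain (exp_set C)] C by rewrite /= CE.
by exists (SigSub (mem_set mC)); rewrite -CE.
Qed.

(* The fibres of [k] are clopen, so the pieces [f i], restricted to the fibres, glue continuously. *)
Lemma glue_homeo (X : topologicalType) (I : Type) (k l : X -> I) (f h : I -> X -> X) :
  locally_constant k -> locally_constant l ->
  (forall i, continuous (f i)) -> (forall i, continuous (h i)) ->
  (forall x, l (f (k x) x) = k x /\ h (k x) (f (k x) x) = x) ->
  (forall x, k (h (l x) x) = l x /\ f (l x) (h (l x) x) = x) ->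
  is_homeo (fun x => f (k x) x).
Proof.
have cont (k' : X -> I) (f' : I -> X -> X) : locally_constant k' ->
    (forall i, continuous (f' i)) -> continuous (fun x => f' (k' x) x).
  move=> kc fc x N Nx.
  have := fc (k' x) x _ Nx; move: (kc x); apply: filterS2 => y /=.
  by rewrite /preimage /= => ->.
move=> kc lc fc hc fP hP; exists (fun x => h (l x) x); split; [|split].
- by move=> x; have [-> ->] := fP x.
- by move=> x; have [-> ->] := hP x.
- by split; exact: cont.
Qed.

(** The constant [y0] is used off [A]. Total maps are what [glue_homeo] takes as pieces. *)
Lemma clopen_extension (X Y : topologicalType) (A : set X) (f : set_type A -> Y) (y0 : Y) :
  clopen A -> continuous f ->
  exists2 F : X -> Y, continuous F & forall a : set_type A, F (set_val a) = f a.
Proof.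
move=> cA cf.
pose F x := if pselect (A x) is left Ax then f (SigSub (mem_set Ax)) else y0.
have FE (a : set_type A) : F (set_val a) = f a.
  rewrite /F; case: pselect => [Aa|]; last by have := set_valP a.
  by congr f; exact: val_inj.
exists F => // x N; have [Ax|nAx] := pselect (A x).
  rewrite -[x]/(set_val (SigSub (mem_set Ax))) FE => /cf[_ [[W oW <-] Wx WN]].
  have nA : nbhs x A by apply: open_nbhs_nbhs; split => //; case: cA.
  have nW : nbhs x W by exact: open_nbhs_nbhs.
  apply: filterS2 nA nW => y Ay Wy; rewrite /preimage /=.
  by rewrite -[y]/(set_val (SigSub (mem_set Ay))) FE; exact: WN.
have Fn y : ~ A y -> F y = y0 by rewrite /F; case: pselect.
rewrite Fn// => Ny; have := clopen_near x cA; apply: filterS => y Ayx.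
by rewrite /preimage /= Fn ?Ayx//; exact: nbhs_singleton.
Qed.

(** The composite of homeomorphisms from [A] to [X] and from [X] to [B], with both directions
    extended to total maps. *)
Lemma clopen_iso (X : topologicalType) (A B : set X) : h_homogeneous X ->
  clopen A -> clopen B -> A !=set0 -> B !=set0 ->
  exists f h : X -> X, [/\ continuous f, continuous h,
    (forall x, A x -> B (f x) /\ h (f x) = x) &
    (forall x, B x -> A (h x) /\ f (h x) = x)].
Proof.
move=> hh cA cB A0 B0.
have [f1 [g1 [fg1 [gf1 [cf1 cg1]]]]] := hh _ cA A0.
have [f2 [g2 [fg2 [gf2 [cf2 cg2]]]]] := hh _ cB B0.
have [a Aa] := A0.
have [F1 cF1 F1E] := clopen_extension a cA cf1.
have [F2 cF2 F2E] := clopen_extension a cB cf2.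
have cv (C : set X) : continuous (set_val : set_type C -> X) := @initial_continuous _ _ set_val.
exists (set_val \o (g2 \o F1)), (set_val \o (g1 \o F2)); split.
- move=> x; apply: continuous_comp; last exact: cv.
  by apply: continuous_comp; [exact: cF1|exact: cg2].
- move=> x; apply: continuous_comp; last exact: cv.
  by apply: continuous_comp; [exact: cF2|exact: cg1].
- move=> x Ax; split; first exact: set_valP.
  by rewrite /= F2E gf2 (F1E (SigSub (mem_set Ax))) fg1.
- move=> x Bx; split; first exact: set_valP.
  by rewrite /= F1E gf1 (F2E (SigSub (mem_set Bx))) fg2.
Qed.

(** Equal ranges mean that a label has both fibres nonempty or both empty; matching nonempty fibres
    are homeomorphic by [clopen_iso], and the pieces are glued. *)
Lemma homeo_relabel (X : topologicalType) (I : Type) (k l : X -> I) :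
  h_homogeneous X -> locally_constant k -> locally_constant l ->
  range k = range l ->
  exists g : Homeo X, forall x, l (homeo_fun g x) = k x.
Proof.
move=> hh kc lc kl.
pose P i (p : (X -> X) * (X -> X)) := [/\ continuous p.1, continuous p.2,
    (forall x, k x = i -> l (p.1 x) = i /\ p.2 (p.1 x) = x) &
    (forall x, l x = i -> k (p.2 x) = i /\ p.1 (p.2 x) = x)].
have [fh fhP] : {fh & forall i, P i (fh i)}.
  apply: choice => i; have [[x kx]|nki] := pselect (exists x, k x = i).
    have [y _ ly] : range l i by rewrite -kl; exists x.
    have [||||f [h [cf ch fP hP]]] := @clopen_iso X (k @^-1` [set i]) (l @^-1` [set i]) hh.
    - exact: clopen_locally_constant.
    - exact: clopen_locally_constant.
    - by exists x.
    - by exists y.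
    by exists (f, h).
  (* For a label with empty fibres the conditions are vacuous, and the identity is a default. *)
  exists (id, id); split => /= [x|x|x kx|x lx]; [exact: cvg_id|exact: cvg_id| |].
    by case: nki; exists x.
  have [y _ ky] : range k i by rewrite kl; exists x.
  by case: nki; exists y.
have [g gE] : exists g : Homeo X, homeo_fun g = fun x => (fh (k x)).1 x.
  apply: homeo_mk; apply: (@glue_homeo _ _ k l (fun i => (fh i).1) (fun i => (fh i).2)) => //.
  - by move=> i; have [] := fhP i.
  - by move=> i; have [] := fhP i.
  - by move=> x; have [_ _ /(_ x erefl)] := fhP (k x).
  - by move=> x; have [_ _ _ /(_ x erefl)] := fhP (l x).
by exists g => x; rewrite gE; have [_ _ /(_ x erefl)[]] := fhP (k x).
Qed.

Lemma locally_constant_comp (X : topologicalType) (I J : Type) (k : X -> I) (r : I -> J) :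
  locally_constant k -> locally_constant (r \o k).
Proof. by move=> kc x; have := kc x; apply: filterS => y /= ->. Qed.

(** Glue a homeomorphism from [A] to [B], its inverse, and the identity elsewhere. The fixed points
    off both sets matter for non-universality. *)
Lemma homeo_swap (X : topologicalType) (A B : set X) : h_homogeneous X ->
  clopen A -> clopen B -> A !=set0 -> B !=set0 -> A `&` B = set0 ->
  exists g : Homeo X, [/\ homeo_fun g @^-1` A = B, homeo_fun g @^-1` B = A &
    forall x, ~ A x -> ~ B x -> homeo_fun g x = x].
Proof.
move=> hh cA cB A0 B0 AB0.
have AB x : A x -> B x -> False by move=> Ax Bx; have : (A `&` B) x by []; rewrite AB0.
have [f [h [cf ch fP hP]]] := clopen_iso hh cA cB A0 B0.
pose k x : bool * bool := (`[< A x >], `[< B x >]).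
have kc : locally_constant k.
  move=> x; apply: filterS2 (clopen_near x cA) (clopen_near x cB) => y.
  by rewrite /k => -> ->.
pose s (b : bool * bool) := (b.2, b.1).
pose u (b : bool * bool) : X -> X := if b.1 then f else if b.2 then h else id.
have uc b : continuous (u b).
  by rewrite /u; case: b.1 => //; case: b.2 => // x; exact: cvg_id.
have kA x : A x -> k x = (true, false).
  by move=> Ax; congr (_, _); [exact: asboolT|apply: asboolF => /AB; exact].
have kB x : B x -> k x = (false, true).
  by move=> Bx; congr (_, _); [apply: asboolF => /AB; exact|exact: asboolT].
have k0 x : ~ A x -> ~ B x -> k x = (false, false).
  by move=> Ax Bx; congr (_, _); exact: asboolF.
have kE x : [\/ k x = (true, false) /\ A x, k x = (false, true) /\ B x |
     [/\ k x = (false, false), ~ A x & ~ B x]].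
  have [Ax|nAx] := pselect (A x); first by apply: Or31; rewrite kA.
  have [Bx|nBx] := pselect (B x); first by apply: Or32; rewrite kB.
  by apply: Or33; rewrite k0.
have uk x : k (u (k x) x) = s (k x) /\ u (s (k x)) (u (k x) x) = x.
  case: (kE x) => [[-> /fP[Bf hf]]|[-> /hP[Ah fh]]|[E nA nB]].
  - by rewrite kB.
  - by rewrite kA.
  - by rewrite E.
have [g gE] : exists g : Homeo X, homeo_fun g = fun x => u (k x) x.
  (* The labelling [s \o k] exchanges the names of [A] and [B], so the swap takes [k] to it label by
     label. *)
  apply: homeo_mk; apply: (@glue_homeo _ _ k (s \o k) u (u \o s)) => //.
  - exact: locally_constant_comp.
  - by move=> b; exact: (uc (s b)).
  - by move=> x; have [kx ux] := uk x; rewrite /= kx; split => //; case: (k x).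
have kg x : k (homeo_fun g x) = s (k x) by rewrite gE; have [] := uk x.
exists g; split.
- apply/seteqP; split => x; rewrite /preimage /=.
    by move=> /kA; rewrite kg => -[Bx _]; apply/asboolP; rewrite Bx.
  by move=> Bx; have := kg x; rewrite (kB _ Bx) => -[Ag _]; apply/asboolP; rewrite Ag.
- apply/seteqP; split => x; rewrite /preimage /=.
    by move=> /kB; rewrite kg => -[_ Bx]; apply/asboolP; rewrite Bx.
  by move=> Ax; have := kg x; rewrite (kA _ Ax) => -[_ Bg]; apply/asboolP; rewrite Bg.
- by move=> x nA nB; rewrite gE (k0 _ nA nB).
Qed.

(** * Order of entry of a maximal chain *)

(** The net is indexed by the neighbourhoods of [l] under reverse inclusion; one choice of [a]
    serves [u] and [v] together. *)
Lemma net_of_nbhs (A : Type) (T : topologicalType) (l : T) (u v : A -> T) :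
  (forall N, nbhs l N -> exists a, N (u a) /\ N (v a)) ->
  exists (I : Type) (le : I -> I -> Prop) (g : I -> A),
    [/\ directed le, net_converges le (fun i => u (g i)) l
      & net_converges le (fun i => v (g i)) l].
Proof.
move=> h; pose I := {N : set T | nbhs l N}.
have [g gP] := choice (fun i : I => h (sval i) (svalP i)).
exists I, (fun M N => sval N `<=` sval M), g; split.
- split; [by move=> i|by move=> i j k ij jk; exact: (subset_trans jk ij)| |].
    by exists (exist _ setT filterT).
  move=> [M lM] [N lN]; exists (exist _ (M `&` N) (filterI lM lN)).
  by split => x /= [].
- by move=> N lN; exists (exist _ N lN) => i /=; apply; have [] := gP i.
- by move=> N lN; exists (exist _ N lN) => i /=; apply; have [] := gP i.
Qed.

(** Every orbit is dense, so a nonempty closed invariant set is everything. *)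
Lemma minimal_of_nbhs (G Y : topologicalType) (act : G -> Y -> Y) :
  (forall (y z : Y) (N : set Y), nbhs z N -> exists g, N (act g y)) -> minimal_action act.
Proof.
move=> h S cS [y Sy] inv; apply/seteqP; split => // z _; apply: cS => N /(h y z N)[g Ng].
by exists (act g y); split => //; exact: inv.
Qed.

Section Chains.
Variable X : topologicalType.
Hypotheses (cX : compact [set: X]) (hX : hausdorff_space X).

(* [y0] is a point of every [F] in [c] meeting [Y]; replacing the trace on [Y] of the intersection
   of these [F] by [y0] gives a set comparable with every member of [c]. *)
Lemma chain_entrance (c : set (Exp X)) (Y : set X) :
  is_maximal_chain c -> clopen Y -> Y !=set0 ->
  exists F y, c F /\ exp_set F `&` Y = [set y].
Proof.
move=> mc [oY cY] Y0; have [chc _] := mc.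
pose D := [set F | c F /\ exp_set F `&` Y !=set0].
have [T TE] : exists T : Exp X, exp_set T = setT.
  by apply: exp_mk; [exact: closedT|have [y _] := Y0; exists y].
have DT : D T.
  split; last by rewrite TE setTI.
  by apply: maximal_chain_comparable => // F _; left; rewrite TE.
have [||_ [F [cF F0] <-]|y0 y0P] := @chain_closed_bigcap X [set exp_set F `&` Y | F in D] cX.
- by exists (exp_set T `&` Y); exists T.
- move=> _ _ [E [cE _] <-] [F [cF _] <-].
  by case: (chc _ _ cE cF) => h; [left|right]; exact: setSI.
- by split => //; apply: closedI => //; exact: exp_closed.
have Yy0 : Y y0 by have [] : (exp_set T `&` Y) y0 by apply: y0P; exists T.
pose M := \bigcap_(F in D) exp_set F.
have [E EE] : exists E : Exp X, exp_set E = (M `&` ~` Y) `|` [set y0].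
  apply: exp_mk; last by exists y0; right.
  apply: closedU; last by apply: accessible_closed_set1; exact: hausdorff_accessible.
  apply: closedI; last exact: open_closedC.
  by apply: closed_bigI => F _; exact: exp_closed.
exists E, y0; split.
  apply: maximal_chain_comparable => // F cF; rewrite EE.
  have [F0|nF0] := pselect (exp_set F `&` Y !=set0).
    right => x [[Mx _]|->]; first exact: Mx.
    by have [] : (exp_set F `&` Y) y0 by apply: y0P; exists F.
  (* A member missing [Y] lies below every member meeting [Y], hence inside [M] and off [Y]. *)
  left => x Fx; left; split; last by move=> Yx; apply: nF0; exists x.
  move=> F' [cF' [z [F'z Yz]]]; case: (chc _ _ cF cF'); first exact.
  by move=> /(_ _ F'z) Fz; case: nF0; exists z.
rewrite EE; apply/seteqP; split=> [x [[[_]|]]//|x ->]; by split => //; right.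
Qed.

(** A label is the rank of its block in the order in which [c] meets the blocks of [Y]: some member
    has reached block [j] and no later one. Keeping [Y] as a parameter allows recursion into smaller
    clopen sets. *)
Definition entered_in_order (Y : set X) (n : nat) (k : X -> nat) (c : set (Exp X)) :=
  forall j, (j < n)%N -> exists F, [/\ c F, (exists x, [/\ exp_set F x, Y x & k x = j]) &
    forall y, exp_set F y -> Y y -> (k y <= j)%N].

(** The part of [Y] outside [A] becomes block 0, witnessed by [F], which meets [Y] only at [y]; the
    blocks inside [A] move up by one. *)
Lemma entered_in_order_cons (c : set (Exp X)) (Y A : set X) n k F y :
  c F -> exp_set F `&` Y = [set y] -> ~ A y ->
  entered_in_order (Y `&` A) n k c ->
  entered_in_order Y n.+1 (fun x => if `[< A x >] then (k x).+1 else 0%N) c.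
Proof.
move=> cF FY nAy kc [_|j /kc[E [cE [x [Ex [Yx Ax] kx]] Ek]]].
  have [Fy Yy] : (exp_set F `&` Y) y by rewrite FY.
  exists F; split => //; first by exists y; rewrite asboolF.
  move=> z Fz Yz; have : (exp_set F `&` Y) z by [].
  by rewrite FY => ->; rewrite asboolF.
exists E; split => //; first by exists x; rewrite asboolT ?kx.
by move=> z Ez Yz; case: asboolP => // Az; rewrite ltnS; exact: Ek.
Qed.

Lemma cons_locally_constant (A : set X) (k : X -> nat) : clopen A -> locally_constant k ->
  locally_constant (fun x => if `[< A x >] then (k x).+1 else 0%N).
Proof. by move=> cA kc x; apply: filterS2 (clopen_near x cA) (kc x) => y -> ->. Qed.

(** Induction on a bound for the list [D] of labels not yet entered: the entrance point [z] of [c]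
    into the region labelled by [D] determines the next block, and its label is removed from [D]. *)
Lemma refine_label (c : set (Exp X)) (s : seq (set X)) :
  is_maximal_chain c -> clopens s -> exists n (k : X -> nat),
  [/\ locally_constant k, (forall x, k x < n)%N,
    (forall x y, k x = k y -> label s x = label s y) & entered_in_order setT n k c].
Proof.
move=> mc cs; have sc := label_locally_constant cs; have [D DP] := label_range s.
suff [n [k [kc kn ks kD]]] : exists n (k : X -> nat), [/\ locally_constant k,
    (forall x, label s x \in D -> k x < n)%N,
    (forall x y, label s x \in D -> label s y \in D -> k x = k y -> label s x = label s y) &
    entered_in_order [set x | label s x \in D] n k c].
  exists n, k; split => //; [by move=> x; exact: kn|by move=> x y; exact: ks|].
  rewrite (_ : setT = [set x | label s x \in D])//.
  by apply/seteqP; split => // x _; exact: DP.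
move: {-1}(size D) (leqnn (size D)) => {DP} m; elim: m D => [|m IH] D.
  rewrite leqn0 => /nilP ->; exists 0%N, (fun=> 0%N); split => //.
  by move=> x; exact: nearW.
move=> Dm; have [[y Dy]|nD] := pselect ([set x | label s x \in D] !=set0); last first.
  exists 0%N, (fun=> 0%N); split => //; first by move=> x; exact: nearW.
  - by move=> x Dx; case: nD; exists x.
  - by move=> x x' Dx; case: nD; exists x.
have [||F [z [cF Fz]]] := @chain_entrance c [set x | label s x \in D] mc.
- exact: (@clopen_locally_constant _ _ (label s) [set b | b \in D]).
- by exists y.
have /= Dz : label s z \in D.
  by have [] : (exp_set F `&` [set x | label s x \in D]) z by rewrite Fz.
pose D' := [seq b <- D | b != label s z].
have memD' x : (label s x \in D') = (label s x != label s z) && (label s x \in D).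
  by rewrite mem_filter.
have [|n [k [kc kn ks kD]]] := IH D'.
  rewrite -ltnS; apply: leq_trans Dm.
  rewrite size_filter -[X in (_ < X)%N](count_predC (pred1 (label s z))).
  by rewrite -[X in (X < _)%N]add0n ltn_add2r -has_count has_pred1.
pose A : set X := label s @^-1` [set b | b != label s z].
exists n.+1, (fun x => if `[< A x >] then (k x).+1 else 0%N); split.
- by apply: cons_locally_constant => //; exact: clopen_locally_constant.
- move=> x Dx; case: asboolP => // Ax; rewrite ltnS; apply: kn.
  by rewrite memD' Dx andbT; exact: Ax.
- move=> x x' Dx Dx'; case: asboolP => Ax; case: asboolP => Ax' //.
    by move=> [kk]; apply: ks => //; rewrite memD' ?Dx ?Dx' andbT.
  by move: Ax Ax' => /negP; rewrite negbK => /eqP -> /negP; rewrite negbK => /eqP ->.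
- apply: entered_in_order_cons cF Fz _ _; first by rewrite /A /preimage /= eqxx.
  rewrite (_ : _ `&` A = [set x | label s x \in D'])//.
  apply/seteqP; split=> x /=; rewrite memD'; first by move=> [-> Ax]; rewrite andbT.
  by move=> /andP[].
Qed.

(** Let [j] be the largest label met by [F]. For [i < j], a member reaching [i] but nothing later
    cannot contain [F], so it is contained in [F], and [F] meets block [i] too. *)
Lemma initial_traces (c : set (Exp X)) n (k : X -> nat) :
  is_chain c -> (forall x, k x < n)%N -> entered_in_order setT n k c ->
  (forall F, c F -> exists2 j, (j < n)%N & k @` exp_set F = [set i | (i <= j)%N]) /\
  (forall j, (j < n)%N -> exists2 F, c F & k @` exp_set F = [set i | (i <= j)%N]).
Proof.
move=> chc kn kc.
have tr F : c F -> exists2 j, (j < n)%N & k @` exp_set F = [set i | (i <= j)%N].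
  move=> cF.
  have exP : exists i, `[< (k @` exp_set F) i >].
    by have [x Fx] := exp_neq0 F; exists (k x); apply/asboolP; exists x.
  have ubP i : `[< (k @` exp_set F) i >] -> (i <= n)%N.
    by move=> /asboolP[x _ <-]; exact: ltnW.
  case: (ex_maxnP exP ubP) => j /asboolP[x Fx kx] jmax.
  have jn : (j < n)%N by rewrite -kx.
  exists j => //; apply/seteqP; split=> i.
    by move=> Fi; apply: jmax; apply/asboolP.
  rewrite /= leq_eqVlt => /predU1P[->|ij]; first by exists x.
  have [E [cE [y [Ey _ ky]] Ek]] := kc i (ltn_trans ij jn).
  case: (chc _ _ cE cF) => [EF|FE]; first by exists y => //; exact: EF.
  by have := Ek x (FE _ Fx) I; rewrite kx leqNgt ij.
split => // j jn; have [F [cF [x [Fx _ kx]] Fk]] := kc j jn.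
exists F => //; have [i _ Fi] := tr F cF; rewrite Fi.
suff -> : i = j by [].
apply/eqP; rewrite eqn_leq; apply/andP; split.
  have [y Fy <-] : (k @` exp_set F) i by rewrite Fi /=.
  exact: Fk.
by have : (k @` exp_set F) j; [exists x|rewrite Fi].
Qed.

Lemma range_entered (c : set (Exp X)) n (k : X -> nat) :
  (forall x, k x < n)%N -> entered_in_order setT n k c -> range k = [set i | (i < n)%N].
Proof.
move=> kn kc; apply/seteqP; split=> [_ [x _ <-]|i /kc[F [_ [x [_ _ <-]] _]]].
  exact: kn.
by exists x.
Qed.

Lemma same_traces_entered (c d : set (Exp X)) n (k l : X -> nat) :
  is_chain c -> is_chain d -> (forall x, k x < n)%N -> (forall x, l x < n)%N ->
  entered_in_order setT n k c -> entered_in_order setT n l d -> same_traces k l c d.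
Proof.
move=> chc chd kn ln kc ld.
have [c1 c2] := initial_traces chc kn kc; have [d1 d2] := initial_traces chd ln ld.
split=> [F /c1[j /d2[E dE Ej] Fj]|E /d1[j /c2[F cF Fj] Ej]].
  by exists E; rewrite ?Fj ?Ej.
by exists F; rewrite ?Fj ?Ej.
Qed.

End Chains.

(** * Moving points, closed sets and maximal chains by homeomorphisms *)

Section Homogeneous.
Variable X : topologicalType.
Hypotheses (iX : ~ finite_set [set: X]) (hhX : h_homogeneous X) (zX : zero_dimensional X).
Hypotheses (cX : compact [set: X]) (hX : hausdorff_space X).

Lemma clopen_infinite (Y : set X) : clopen Y -> Y !=set0 -> ~ finite_set Y.
Proof.
move=> cY Y0 finY; apply: iX.
have [f [g [fg [gf [cf cg]]]]] := hhX cY Y0.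
have [y Yy] := Y0; have [F _ FE] := clopen_extension y cY cf.
apply: sub_finite_set (finite_image F finY) => x _.
by exists (set_val (g x)); [exact: set_valP|rewrite FE gf].
Qed.

(** [Y] is infinite, so it has a point besides [y] and [z]. Two points are avoided because two
    chains have two entrance points. *)
Lemma clopen_avoiding (Y : set X) (y z : X) : clopen Y -> Y !=set0 ->
  exists A t, [/\ clopen A, A t, A `<=` Y, ~ A y & ~ A z].
Proof.
move=> cY Y0.
have [t [Yt ty tz]] : exists t, [/\ Y t, t <> y & t <> z].
  apply: contrapT => nt; apply: (clopen_infinite cY Y0).
  apply: (@sub_finite_set _ _ [set y; z]); last exact: finite_set2.
  move=> t Yt; apply: contrapT => /not_orP[ty tz]; by apply: nt; exists t.
have o1 (x : X) : open (~` [set x]).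
  by apply: closed_openC; apply: accessible_closed_set1; exact: hausdorff_accessible.
have [|A [cA At Ayz]] := @clopen_nbhs X cX hX zX t (Y `&` (~` [set y] `&` ~` [set z])).
  apply: open_nbhs_nbhs; split => //; apply: openI; first by case: cY.
  exact: openI.
by exists A, t; split => // [x /Ayz[]//|/Ayz[_ [/(_ erefl)]]|/Ayz[_ [_ /(_ erefl)]]].
Qed.

(** The chains enter [Y] at [y] and [z]; a clopen [A] inside [Y] avoiding both makes the rest of [Y]
    the first block for both chains, and the induction continues inside [A]. *)
Lemma common_order (c d : set (Exp X)) n (Y : set X) :
  is_maximal_chain c -> is_maximal_chain d -> clopen Y -> Y !=set0 ->
  exists k : X -> nat, [/\ locally_constant k, (forall x, Y x -> k x < n.+1)%N,
    entered_in_order Y n.+1 k c & entered_in_order Y n.+1 k d].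
Proof.
move=> mc md; elim: n Y => [|n IH] Y cY Y0;
  have [F [y [cF Fy]]] := chain_entrance cX hX mc cY Y0;
  have [E [z [dE Ez]]] := chain_entrance cX hX md cY Y0.
  have h G w (b : set (Exp X)) : b G -> exp_set G `&` Y = [set w] ->
      entered_in_order Y 1 (fun=> 0%N) b.
    move=> bG Gw [|//] _; exists G; split => //.
    by exists w; have [] : (exp_set G `&` Y) w by rewrite Gw.
  exists (fun=> 0%N); split => //; [by move=> x; exact: nearW|exact: h cF Fy|exact: h dE Ez].
have [A [t [cA At AY Ay Az]]] := clopen_avoiding y z cY Y0.
have [||k [kc kn kC kD]] := IH (Y `&` A).
- exact: clopenI.
- by exists t; split => //; exact: AY.
exists (fun x => if `[< A x >] then (k x).+1 else 0%N); split.
- exact: cons_locally_constant.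
- by move=> x Yx; case: asboolP => // Ax; rewrite ltnS; exact: kn.
- exact: entered_in_order_cons cF Fy Ay kC.
- exact: entered_in_order_cons dE Ez Az kD.
Qed.

(** Order the blocks of a partition by their entry into the target [c], take equally many blocks
    entered in a common order by [c1] and [c2], and let a homeomorphism match the blocks by rank. *)
Lemma phi_move (c c1 c2 : Phi X) (N : set (Phi X)) : nbhs c N ->
  exists g : Homeo X, N (actPhi g c1) /\ N (actPhi g c2).
Proof.
move=> /(phi_trace_nbhs cX hX zX)[s cs sN].
have mc := @phi_maximal_chain X.
(* The case of no blocks is impossible, since a point of [X] has a label below the number of
   blocks. *)
have [[|n] [l [lc ln ls lo]]] := refine_label cX hX (mc c) cs.
  by have [F _] := exp_neq0 (set_val c); have [x _] := exp_neq0 F; have := ln x.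
have [||k [kc kn k1 k2]] := @common_order (phi_set c1) (phi_set c2) n setT (mc _) (mc _).
- exact: clopenT.
- by have [F _] := exp_neq0 (set_val c); have [x _] := exp_neq0 F; exists x.
have {}kn x : (k x < n.+1)%N by exact: kn.
have [|g gP] := homeo_relabel hhX kc lc.
  by rewrite (range_entered kn k1) (range_entered ln lo).
have key d : entered_in_order setT n.+1 k (phi_set d) -> N (actPhi g d).
  move=> dk; apply: sN.
  have [h1 h2] := same_traces_entered (proj1 (mc d)) (proj1 (mc c)) kn ln dk lo.
  have gE F : l @` exp_set (actExp g F) = k @` exp_set F.
    by rewrite actExpE image_comp; apply: eq_imagel => x _; exact: gP.
  split; rewrite actPhiE// => F.
    move=> [G dG <-]; have [E cE GE] := h1 G dG; exists E => //.
    by apply: image_factor ls _; rewrite gE.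
  move=> /h2[G dG GF]; exists (actExp g G); first by exists G.
  by apply: image_factor ls _; rewrite gE.
by exists g; split; exact: key.
Qed.

(** A point outside a clopen [A] is moved into [A] by exchanging [A] with its complement. *)
Lemma minimal_X : minimal_action (@actX X).
Proof.
apply: minimal_of_nbhs => x y N /(clopen_nbhs cX hX zX)[A [cA Ay AN]].
have [Ax|nAx] := pselect (A x).
  have [g gE] : exists g : Homeo X, homeo_fun g = id.
    by apply: homeo_mk; exists id; do 3?split => //; move=> z; exact: cvg_id.
  by exists g; apply: AN; rewrite /actX gE.
have [||||g [_ gA _]] := @homeo_swap X (~` A) A hhX _ cA.
- exact: clopenC.
- by exists x.
- by exists y.
- by rewrite setICl.
by exists g; apply: AN; have : (homeo_fun g @^-1` A) x by rewrite gA.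
Qed.

Lemma extremely_proximal : extremely_proximal_X X.
Proof.
move=> F FT; have [x0 _] := exp_neq0 F.
have [E0 E0E] : exists E0 : Exp X, exp_set E0 = [set x0].
  apply: exp_mk; last by exists x0.
  by apply: accessible_closed_set1; exact: hausdorff_accessible.
(* The conjunct is doubled to fit [net_of_nbhs] with both maps equal. *)
suff h : forall N, nbhs E0 N -> exists g : Homeo X, N (actExp g F) /\ N (actExp g F).
  by have [I [le [g [dl gl _]]]] := net_of_nbhs h; exists I, le, g, x0, E0.
move=> N /(exp_trace_nbhs cX hX zX)[s cs sN].
pose V := label s @^-1` [set label s x0].
have cV : clopen V by apply: clopen_locally_constant; exact: label_locally_constant.
suff [g gV] : exists g : Homeo X, homeo_fun g @` exp_set F `<=` V.
  exists g; suff : N (actExp g F) by [].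
  apply: sN; rewrite E0E image_set1; apply/seteqP; split.
    by move=> _ [x gx <-]; apply: gV; rewrite -actExpE.
  move=> _ ->; have [x Fx] := exp_neq0 (actExp g F); exists x => //.
  by apply: gV; rewrite -actExpE.
have [VT|nVT] := pselect (V = setT).
  have [g _] : exists g : Homeo X, homeo_fun g = id.
    by apply: homeo_mk; exists id; do 3?split => //; move=> z; exact: cvg_id.
  by exists g; rewrite VT.
have [y nFy] : exists y, ~ exp_set F y.
  by apply: contrapT => /forallNP nF; apply: FT; apply/seteqP; split => // y _; exact: contrapT.
have [v nVv] : exists v, ~ V v.
  by apply: contrapT => /forallNP nV; apply: nVT; apply/seteqP; split => // v _; exact: contrapT.
have [|A [cA Ay AF]] := @clopen_nbhs X cX hX zX y (~` exp_set F).
  by apply: open_nbhs_nbhs; split => //; apply: closed_openC; exact: exp_closed.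
have Al (B : set X) : clopen B -> locally_constant (fun x => B x).
  by move=> cB x; exact: clopen_near.
(* With truth values as labels, [g] carries the complement of [A], and so [F], into [V]; both
   labellings take both values. *)
have [||g gP] := @homeo_relabel X Prop (fun x => ~ A x) (fun x => V x) hhX _ (Al _ cV).
- by apply: (Al (~` A)); exact: clopenC.
- have full (f : X -> Prop) x x' : f x -> ~ f x' -> range f = setT.
    move=> fx nfx'; apply/seteqP; split => // P _; have [p|np] := pselect P.
      by exists x => //; apply/propext; split.
    by exists x' => //; apply/propext; split.
  have [x Fx] := exp_neq0 F.
  by rewrite (full V x0 v)// (full (~` A) x y)//; move=> /AF.
by exists g => _ [x Fx <-]; rewrite gP => /AF.
Qed.

End Homogeneous.

(** * Tournaments on clopen sets *)

Lemma compact_set_type (T : topologicalType) (A : set T) :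
  compact A -> compact [set: set_type A].
Proof.
move=> cA F PF _.
have FA : F ((set_val : set_type A -> T) @^-1` A).
  by apply: (@filterE _ F) => x; exact: (set_valP x).
have [p [Ap clp]] := cA (set_val @ F) _ FA.
exists (SigSub (mem_set Ap)); split => // B N FB [_ [[W oW <-] Wp WN]].
have [_ [[x Bx <-] Wx]] : (set_val @` B) `&` W !=set0.
  apply: clp; last exact: open_nbhs_nbhs.
  by apply: (@filterS _ F _ B) => // x Bx; exists x.
by exists x; split => //; exact: WN.
Qed.

Lemma hausdorff_set_type (T : topologicalType) (A : set T) :
  hausdorff_space T -> hausdorff_space (set_type A).
Proof.
move=> hT p q clpq; apply: val_inj; apply: hT => B C.
have cv := @initial_continuous _ _ (set_val : set_type A -> T).
by move=> /cv pB /cv qC; have [x [Bx Cx]] := clpq _ _ pB qC; exists (set_val x).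
Qed.

(** Zorn's lemma is applied to the removed sets [A], so that a union of a chain of them corresponds
    to an intersection of closed invariant sets, nonempty by compactness. *)
Lemma exists_minimal_subset (G Y : topologicalType) (act : G -> Y -> Y) (W : set Y) :
  compact [set: Y] -> closed W -> W !=set0 -> (forall g y, W y -> W (act g y)) ->
  exists M, [/\ M `<=` W, closed M, M !=set0, (forall g y, M y -> M (act g y)) &
    forall S, closed S -> S !=set0 -> (forall g y, S y -> S (act g y)) -> S `<=` M -> S = M].
Proof.
move=> cY cW W0 iW.
pose P A := [/\ closed (W `\` A), W `\` A !=set0 &
  forall g y, (W `\` A) y -> (W `\` A) (act g y)].
have [F FP totF|A [[cA A0 iA] Amax]] := @Zorn_bigcup Y P.
  have DE : W `\` \bigcup_(A in F) A = W `&` \bigcap_(A in F) (W `\` A).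
    apply/seteqP; split=> y [Wy h]; split => //.
      by move=> A FA; split => // Ay; apply: h; exists A.
    by move=> [A FA Ay]; have [] := h A FA.
  split; rewrite DE.
  - by apply: closedI => //; apply: closed_bigI => A /FP[].
  - have [F0|F0] := pselect (F !=set0); last first.
      by have [w Ww] := W0; exists w; split => // A FA; case: F0; exists A.
    have [A FA] := F0.
    have [||_ [B /FP[cB B0 _] <-]//|y yP] :=
      @chain_closed_bigcap Y [set W `\` B | B in F] cY.
    + by exists (W `\` A); exists A.
    + move=> _ _ [B FB <-] [C FC <-].
      by case: (totF _ _ FB FC) => h; [right|left]; exact: setDS.
    exists y; split; first by have [] : (W `\` A) y by apply: yP; exists A.
    by move=> B FB; apply: yP; exists B.
  - move=> g y [Wy h]; split; first exact: iW.
    by move=> B FB; have [_ _ iB] := FP _ FB; apply: iB; exact: h.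
exists (W `\` A); split => //.
move=> S cS S0 iS SM; apply/seteqP; split => // y My; apply: contrapT => nSy.
have DS : W `\` (A `|` ~` S) = S.
  apply/seteqP; split=> z; first by move=> [_ /not_orP[_ /contrapT]].
  by move=> Sz; have [Wz nAz] := SM _ Sz; split => // -[].
apply: (Amax (A `|` ~` S)); last by rewrite /P DS.
by split => [|h]; [exact: subsetUl|case: My => _; apply; apply: h; right].
Qed.

Lemma cvg_ptws_bool (D : Type) (F : set_system {ptws D -> bool}) (phi : {ptws D -> bool}) :
  Filter F -> (forall d, F [set psi | psi d = phi d]) -> F --> phi.
Proof.
move=> FF h; apply/cvg_sup => d A [_ [[B oB <-] Bphi BA]].
by apply: filterS BA _; apply: filterS (h d) => psi; rewrite /preimage /= => ->.
Qed.

Lemma near_ptws_bool (D : eqType) (phi : {ptws D -> bool}) d :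
  \forall psi \near phi, psi d = phi d.
Proof.
apply: (@proj_continuous D (fun=> bool) d phi [set b | b = phi d]).
by apply: open_nbhs_nbhs; split => //; exact: discrete_open.
Qed.

Section Tournaments.
Variable X : topologicalType.
Hypotheses (iX : ~ finite_set [set: X]) (hhX : h_homogeneous X) (zX : zero_dimensional X).
Hypotheses (cX : compact [set: X]) (hX : hausdorff_space X).

Let D := set_type [set p : set X * set X | clopen p.1 /\ clopen p.2].

Lemma clopen_pair_mk (A B : set X) : clopen A -> clopen B ->
  exists d : D, set_val d = (A, B).
Proof.
move=> cA cB.
by exists (SigSub (mem_set (conj cA cB :
  [set p : set X * set X | clopen p.1 /\ clopen p.2] (A, B)))).
Qed.

Lemma clopen_pairP (d : D) : clopen (set_val d).1 /\ clopen (set_val d).2.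
Proof. exact: (set_valP d). Qed.

Lemma pull_exists (g : Homeo X) (d : D) : exists d' : D,
  set_val d' = (homeo_fun g @^-1` (set_val d).1, homeo_fun g @^-1` (set_val d).2).
Proof.
have [c1 c2] := clopen_pairP d.
by apply: clopen_pair_mk; apply: preimage_clopen => //; exact: homeo_continuous.
Qed.

Definition pull (g : Homeo X) (d : D) : D := projT1 (cid (pull_exists g d)).

Lemma pullE g d : set_val (pull g d) =
  (homeo_fun g @^-1` (set_val d).1, homeo_fun g @^-1` (set_val d).2).
Proof. by rewrite /pull; case: cid. Qed.

(** A left action, since [pull] reverses composition. *)
Definition act_tournament (g : Homeo X) (phi : {ptws D -> bool}) : {ptws D -> bool} :=
  fun d => phi (pull g d).

(* For each pair of distinct clopen sets, a tournament selects exactly one of its two orderings. *)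
Definition tournament : set {ptws D -> bool} :=
  [set phi | forall d e, (set_val e) = ((set_val d).2, (set_val d).1) ->
     (set_val d).1 <> (set_val d).2 -> phi e = ~~ phi d].

Lemma tournament_closed : closed tournament.
Proof.
move=> phi clphi d e de ne.
have [psi [tpsi [<- <-]]] := clphi _ (filterI (near_ptws_bool phi e) (near_ptws_bool phi d)).
exact: tpsi.
Qed.

Lemma tournament_neq0 : tournament !=set0.
Proof.
(* [ch] depends only on the unordered pair, so exactly one of the two orderings of distinct sets
   begins with the chosen set. *)
pose ch (p : set X * set X) := xget set0 [set A | A = p.1 \/ A = p.2].
exists (fun d => `[< ch (set_val d) = (set_val d).1 >]) => d e -> /= ne.
have -> : ch ((set_val d).2, (set_val d).1) = ch (set_val d).
  rewrite /ch; congr xget; apply/seteqP; split=> A /=; tauto.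
have : [set A | A = (set_val d).1 \/ A = (set_val d).2] (ch (set_val d)).
  by apply: xgetPex; exists (set_val d).1; left.
move=> [] ->; first by rewrite (asboolT (erefl _)) asboolF.
by rewrite (asboolT (erefl _)) asboolF// => h; apply: ne.
Qed.

Lemma act_tournament_stable g phi : tournament phi -> tournament (act_tournament g phi).
Proof.
move=> tphi d e de ne; apply: tphi; rewrite !pullE ?de//= => h; apply: ne.
have [g' [_ g'K]] := homeo_inv g.
have h' : forall x, (set_val d).1 (homeo_fun g x) = (set_val d).2 (homeo_fun g x).
  by move=> x; rewrite -[LHS]/((homeo_fun g @^-1` (set_val d).1) x) h.
by apply/funext => x; rewrite -(g'K x).
Qed.

(** Mapping the compact preimage of [A] into [A], and that of the complement into the complement,
    are open conditions on [h] that together fix the preimage of [A]. *)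
Lemma near_preimage (g : Homeo X) (A : set X) : clopen A ->
  \forall h \near g, homeo_fun h @^-1` A = homeo_fun g @^-1` A.
Proof.
move=> cA; have oc B : clopen B ->
    nbhs g [set h : Homeo X | homeo_fun h @` (homeo_fun g @^-1` B) `<=` B].
  move=> cB; apply: open_nbhs_nbhs; split; last by move=> _ [x Bx <-].
  apply: (@open_set_val {compact-open, X -> X}
    [set f : {compact-open, X -> X} | @is_homeo X f]
    [set f | f @` (homeo_fun g @^-1` B) `<=` B]).
  apply: compact_open_open; last by case: cB.
  apply: (subclosed_compact _ cX) => //.
  have /continuous_closedP := @homeo_continuous _ g; apply; by case: cB.
apply: filterS2 (oc A cA) (oc (~` A) (clopenC A cA)) => h hA hnA.
apply/seteqP; split=> x; rewrite /preimage /= => Ax; last by apply: hA; exists x.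
by apply: contrapT => nAx; apply: (hnA (homeo_fun h x)) => //; exists x.
Qed.

Lemma near_pull (g : Homeo X) d : \forall h \near g, pull h d = pull g d.
Proof.
have [c1 c2] := clopen_pairP d.
apply: filterS2 (near_preimage g c1) (near_preimage g c2) => h h1 h2.
by apply: val_inj; rewrite /= -!set_valE !pullE h1 h2.
Qed.

Section Restriction.
Variable M : set {ptws D -> bool}.
Hypothesis iM : forall g phi, M phi -> M (act_tournament g phi).

Definition act_restr (g : Homeo X) (z : set_type M) : set_type M :=
  SigSub (mem_set (iM g (set_valP z))).

Lemma act_restr_Gspace : is_Gspace act_restr.
Proof.
split.
- move=> e eid; apply/funext => z; apply: val_inj => /=; apply/funext => d.
  rewrite /act_tournament; congr (set_val z _); apply: val_inj => /=.
  by rewrite -set_valE pullE eid; case: (set_val d).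
- move=> g h k kE; apply/funext => z; apply: val_inj => /=; apply/funext => d.
  rewrite /act_tournament /=; congr (set_val z _); apply: val_inj => /=.
  by rewrite -!set_valE !pullE kE.
(* Coordinate [d] of the image depends only on [pull h d], locally constant in [h], and on one
   coordinate of [w]. *)
- move=> [g z]; apply: cvg_set_type; apply: cvg_ptws_bool => d.
  exists ([set h | pull h d = pull g d],
    [set w | set_val w (pull g d) = set_val z (pull g d)]).
    split => /=; first exact: near_pull.
    exact: (initial_continuous (near_ptws_bool (set_val z) (pull g d))).
  move=> [h w] [/= hd wd].
  suff : act_tournament h (set_val w) d = act_tournament g (set_val z) d by [].
  by rewrite /act_tournament hd.
Qed.

End Restriction.

(** An equivariant map sends [x] to a tournament fixed by the stabiliser of [x]; a homeomorphism
    fixing [x] and swapping disjoint clopen sets fixes no tournament. *)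
Lemma not_universal : ~ universal_minimal (@actX X).
Proof.
move=> [_ /= univ].
have cY : compact [set: {ptws D -> bool}].
  have := @tychonoff D (fun=> bool) (fun=> setT) (fun=> bool_compact).
  by congr compact; apply/seteqP; split.
have hY : hausdorff_space {ptws D -> bool}.
  by apply: (@hausdorff_product D (fun=> bool)) => _; exact: discrete_hausdorff.
have [M [MW cM M0 iM minM]] := @exists_minimal_subset (Homeo X) _ act_tournament _ cY
  tournament_closed tournament_neq0 act_tournament_stable.
have [|||||f [_ _ fg]] := univ (set_type M) (act_restr iM).
- exact: act_restr_Gspace.
- by apply: compact_set_type; exact: subclosed_compact cM cY _.
- exact: hausdorff_set_type.
- by have [m Mm] := M0; exists (SigSub (mem_set Mm)).
- move=> S cS [z Sz] iS.
  (* Minimality transfers from subsets of [M] to the subspace: the image of [S] is compact, hence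
     closed in the full product. *)
  have SM : set_val @` S = M.
    apply: minM.
    + have cSt : compact S.
        by apply: (subclosed_compact cS (compact_set_type (subclosed_compact cM cY _))).
      apply: compact_closed => //; apply: continuous_compact => //.
      by apply: continuous_subspaceT; exact: initial_continuous.
    + by exists (set_val z); exists z.
    + by move=> g _ [w Sw <-]; exists (act_restr iM g w) => //; exact: iS.
    + by move=> _ [w _ <-]; exact: set_valP.
  apply/seteqP; split => // w _.
  have [w' Sw' /val_inj <-//] : (set_val @` S) (set_val w) by rewrite SM; exact: set_valP.
have [x _] : [set: X] !=set0.
  by apply/set0P/eqP => X0; apply: iX; rewrite X0; exact: finite_set0.
have [|A [t [cA At _ Ax _]]] := clopen_avoiding iX hhX zX cX hX x x (@clopenT X).
  by exists x.
have [|B [u [cB Bu BA Bx _]]] := clopen_avoiding iX hhX zX cX hX x x (clopenC A cA).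
  by exists x.
have [|||g [gA gB gx]] := @homeo_swap X A B hhX cA cB.
- by exists t.
- by exists u.
- by rewrite -subset0 => y [Ay /BA].
have [d dE] := clopen_pair_mk cA cB.
have fx : set_val (f x) = act_tournament g (set_val (f x)).
  by rewrite -{1}(gx x Ax Bx) -[homeo_fun g x]/(actX g x) fg.
(* [pull g d] is the pair [(B, A)]: a tournament takes opposite values at it and at [d], while
   invariance under [g] makes them equal. *)
have := MW _ (set_valP (f x)) d (pull g d).
rewrite pullE dE /= gA gB => /(_ erefl) h.
have : set_val (f x) (pull g d) = ~~ set_val (f x) d.
  by apply: h => AB; apply: (BA t) => //; rewrite -AB.
by rewrite {2}fx /act_tournament; case: (set_val (f x) (pull g d)).
Qed.

End Tournaments.

Theorem theorem3p5 (X : topologicalType) :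
  ~ finite_set [set: X] ->
  h_homogeneous X ->
  zero_dimensional X ->
  compact [set: X] ->
  hausdorff_space X ->
  [/\ minimal_action (@actX X),
      extremely_proximal_X X,
      ~ universal_minimal (@actX X),
      minimal_action (@actPhi X)
    & proximal_action (@actPhi X)].
Proof.
move=> iX hhX zX cX hX; split.
- exact: minimal_X.
- exact: extremely_proximal.
- exact: not_universal.
- apply: minimal_of_nbhs => c d N dN.
  by have [g [Ng _]] := phi_move iX hhX zX cX hX c c dN; exists g.
- move=> c d.
  (* The common limit may be prescribed; [c] itself is chosen. *)
  have [N Nc|I [le [g [dle gc gd]]]] := @net_of_nbhs _ _ c
    (fun g => actPhi g c) (fun g => actPhi g d).
    exact: (phi_move iX hhX zX cX hX c d Nc).
  by exists I, le, g, c.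
Qed.
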